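(* Let $T$ be a finite tree with diameter at least $3$ and maximum degree $\Delta \ge 3$, or an infinite tree with finite maximum degree $\Delta \ge 3$. Then, for any integer $h \ge \Delta$, $$\sigma_{h,1,1}(T) = \sigma^*_{h,1,1}(T) = 2h + \Delta - 1,$$ and for finite trees $T$ (with diameter at least $3$ and maximum degree $\Delta \ge 3$, and with $h\ge\Delta$) there exists a linear time exact algorithm for computing $\sigma_{h,1,1}(T)$. In particular, for integers $m,k\ge2$, for $T = T_{m,k}$, $T_{m,\infty}$, $\hat{T}_{m,k}$ or $\hat{T}_{m,\infty}$, and any integer $h \ge m+1$, $$\sigma_{h,1,1}(T) = \sigma^*_{h,1,1}(T) = 2h + m.$$
   Context: Infinite graphs have countably infinitely many vertices. $N(u)$ is the neighbourhood of $u$ and $d(u,v)$ the distance between $u$ and $v$. For a positive integer $\ell$, $|x|_\ell=\min\{|x|,\ell-|x|\}$. A $C(h_1,h_2,h_3)$-labelling of a graph $G$ with span $\ell$ is a mapping $f: V(G)\to\{0,1,\ldots,\ell-1\}$ such that for $i=1,2,3$ and any $u,v\in V(G)$ with $d(u,v)=i$ we have $|f(u)-f(v)|_\ell\ge h_i$. $\sigma_{h_1,h_2,h_3}(G)$ is the minimum integer $\ell$ such that $G$ admits a $C(h_1,h_2,h_3)$-labelling with span $\ell$. An interval modulo $\ell$ is a set of the form $\{a \bmod \ell, (a+1) \bmod \ell, \ldots, b \bmod \ell\}$ (going cyclically from $a$ to $b$). A $C(h_1,h_2,h_3)$-labelling $f$ with span $\ell$ is elegant if for every vertex $u$ there is an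 interval $I_u$ modulo $\ell$ such that $f(N(u))\subseteq I_u$, and for every edge $uv$, $I_u\cap I_v=\emptyset$. $\sigma^*_{h_1,h_2,h_3}(G)$ is the minimum $\ell$ such that $G$ admits an elegant $C(h_1,h_2,h_3)$-labelling with span $\ell$ ($\infty$ if none exists). Linear time means linear in $|V(T)|$. $T_{m,k}$ is the complete $m$-ary tree of height $k$: the rooted tree in which every non-leaf vertex has exactly $m$ children and all leaves are at level (distance from the root) $k$. $T_{m,\infty}$ is the infinite complete $m$-ary tree: the rooted tree with countably infinitely many vertices in which every vertex (including the root) has exactly $m$ children. $\hat{T}_{m,\infty}$ is the infinite $(m+1)$-regular tree, and $\hat{T}_{m,k}$ is its finite subtree induced by all vertices at distance at most $k$ from a fixed vertex. *)

(* Defs.v *)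
From HB Require Import structures.
From mathcomp Require Import all_boot all_order all_algebra.
From mathcomp Require Import boolp classical_sets functions cardinality.

Set Implicit Arguments.
Unset Strict Implicit.
Unset Printing Implicit Defensive.

Import Order.TTheory GRing.Theory Num.Theory.

Local Open Scope classical_set_scope.
Local Open Scope nat_scope.

(* The minimum of a set of naturals; None stands for infinity. *)
Definition minnat (P : nat -> Prop) : option nat :=
  match pselect (exists n, `[< P n >]) with
  | left exP => Some (ex_minn exP)
  | right _ => None
  end.

Lemma minnatP (P : nat -> Prop) (n : nat) :
  minnat P = Some n <-> P n /\ forall i, P i -> n <= i.
Proof.
rewrite /minnat; case: pselect => [exP|nexP]; last first.
  by split=> [//|[Pn _]]; case: nexP; exists n; apply/asboolP.
case: ex_minnP => i /asboolP Pi mini; split=> [[<-]|[Pn minn]].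
  by split=> // j Pj; apply: mini; apply/asboolP.
congr Some; apply/eqP; rewrite eqn_leq minn // andbT.
by apply: mini; apply/asboolP.
Qed.

(* Simple graphs with countably many (finitely or infinitely many) vertices. *)
Record graph := Graph {
  vertex :> countType;
  adj : rel vertex;
  adj_sym : symmetric adj;
  adj_irr : irreflexive adj
}.

Definition neighbours (G : graph) (u : G) : set G := [set v | adj u v].

Definition finite_graph (G : graph) : Prop := finite_set [set: G].

Definition infinite_graph (G : graph) : Prop := infinite_set [set: G].

Definition connected_graph (G : graph) : Prop :=
  forall u v : G, exists p : seq G, path (@adj G) u p /\ last u p = v.

Definition acyclic_graph (G : graph) : Prop :=
  forall c : seq G, 2 < size c -> ~ ucycle (@adj G) c.

Definition tree (G : graph) : Prop := connected_graph G /\ acyclic_graph G.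

Definition dist (G : graph) (u v : G) : option nat :=
  minnat (fun n => exists p : seq G,
    [/\ path (@adj G) u p, last u p = v & size p = n]).

Definition diameter_ge (G : graph) (n : nat) : Prop :=
  exists (u v : G) (d : nat), dist u v = Some d /\ n <= d.

Definition has_degree (G : graph) (u : G) (d : nat) : Prop :=
  (neighbours u #= `I_d)%card.

Definition has_max_degree (G : graph) (D : nat) : Prop :=
  (forall u : G, exists2 d, has_degree u d & d <= D) /\
  (exists u : G, has_degree u D).

(* |x|_l, only used with |x| < l, so that the subtraction is exact. *)
Definition circ_norm (l : nat) (x : int) : nat :=
  minn `|x|%N (l - `|x|%N).

Definition C_labelling (h1 h2 h3 : nat) (G : graph) (l : nat)
    (f : G -> 'I_l) : Prop :=
  forall u v : G,
    [/\ dist u v = Some 1 -> h1 <= circ_norm l ((f u)%:Z - (f v)%:Z)%R,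
        dist u v = Some 2 -> h2 <= circ_norm l ((f u)%:Z - (f v)%:Z)%R
      & dist u v = Some 3 -> h3 <= circ_norm l ((f u)%:Z - (f v)%:Z)%R].

(* {a mod l, (a+1) mod l, ..., b mod l}; a cyclic interval that wraps around
   is obtained by taking b >= l. *)
Definition interval_mod (l : nat) (I : set 'I_l) : Prop :=
  exists a b : nat, a <= b /\
    I = [set x : 'I_l | exists2 c, a <= c <= b & x = c %% l :> nat].

Definition elegant (G : graph) (l : nat) (f : G -> 'I_l) : Prop :=
  exists I : G -> set 'I_l,
    [/\ forall u, interval_mod (I u),
        forall u, f @` neighbours u `<=` I u
      & forall u v, adj u v -> I u `&` I v = set0].

Definition sigma (h1 h2 h3 : nat) (G : graph) : option nat :=
  minnat (fun l => 0 < l /\ exists f : G -> 'I_l, C_labelling h1 h2 h3 f).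

Definition sigma_star (h1 h2 h3 : nat) (G : graph) : option nat :=
  minnat (fun l => 0 < l /\
    exists f : G -> 'I_l, C_labelling h1 h2 h3 f /\ elegant f).

Definition children (G : graph) (r u : G) : set G :=
  [set v | adj u v /\ exists2 d, dist r u = Some d & dist r v = Some d.+1].

(* G is (a copy of) T_{m,k}. *)
Definition complete_tree (m k : nat) (G : graph) : Prop :=
  tree G /\ exists r : G, forall u : G,
    [/\ exists2 d, dist r u = Some d & d <= k,
        children r u = set0 -> dist r u = Some k
      & children r u <> set0 -> (children r u #= `I_m)%card].

(* G is (a copy of) T_{m,oo}. *)
Definition complete_tree_infty (m : nat) (G : graph) : Prop :=
  [/\ tree G, infinite_graph G &
      exists r : G, forall u : G, (children r u #= `I_m)%card].

(* G is (a copy of) \hat T_{m,oo}. *)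
Definition regular_tree (m : nat) (G : graph) : Prop :=
  [/\ tree G, infinite_graph G & forall u : G, has_degree u m.+1].

Section Induced.
Variables (G : graph) (P : pred G).

Definition induced_adj : rel {v : G | P v} :=
  fun u v => adj (val u) (val v).

Lemma induced_adj_sym : symmetric induced_adj.
Proof. by move=> u v; apply: adj_sym. Qed.

Lemma induced_adj_irr : irreflexive induced_adj.
Proof. by move=> u; apply: adj_irr. Qed.

Definition induced : graph := Graph induced_adj_sym induced_adj_irr.

End Induced.

Definition in_ball (G : graph) (x : G) (k : nat) : pred G :=
  fun v => if dist x v is Some d then d <= k else false.

(* G is (a copy of) \hat T_{m,k}. *)
Definition regular_tree_ball (m k : nat) (G : graph) : Prop :=
  exists (H : graph) (x : H), regular_tree m H /\ G = induced (in_ball x k).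

(* Linear time refers to the following random-access machine with unit cost
   per instruction. It has registers and an indirectly addressed memory, both
   holding words, i.e., naturals smaller than a bound W. The only arithmetic
   operations are addition and truncated subtraction, and writing a value that
   does not fit in a word is a fault. The machine halts when the program
   counter leaves the program; the output is then in register 0. *)
Inductive instr :=
  | IConst of nat & nat        (* IConst d c  : R[d] := c              *)
  | IAdd of nat & nat & nat    (* IAdd d a b  : R[d] := R[a] + R[b]    *)
  | ISub of nat & nat & nat    (* ISub d a b  : R[d] := R[a] - R[b]    *)
  | IRead of nat & nat         (* IRead d a   : R[d] := M[R[a]]        *)
  | IWrite of nat & nat        (* IWrite a b  : M[R[a]] := R[b]        *)
  | IJle of nat & nat & nat.   (* IJle a b t  : if R[a] <= R[b] goto t *)

Definition program := seq instr.

Record state := State { pc : nat; regs : nat -> nat; memory : nat -> nat }.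

Definition set_reg (W : nat) (s : state) (d x : nat) : option state :=
  if x < W then Some (State (pc s).+1 [eta regs s with d |-> x] (memory s))
  else None.

Definition exec_instr (W : nat) (i : instr) (s : state) : option state :=
  let R := regs s in
  match i with
  | IConst d c => set_reg W s d c
  | IAdd d a b => set_reg W s d (R a + R b)
  | ISub d a b => set_reg W s d (R a - R b)
  | IRead d a => set_reg W s d (memory s (R a))
  | IWrite a b => Some (State (pc s).+1 R [eta memory s with R a |-> R b])
  | IJle a b t => Some (State (if R a <= R b then t else (pc s).+1) R (memory s))
  end.

Definition step (W : nat) (P : program) (s : state) : option state :=
  if onth P (pc s) is Some i then exec_instr W i s else None.

Fixpoint steps (W : nat) (P : program) (t : nat) (s : state) : option state :=
  if t is t'.+1 then obind (steps W P t') (step W P s) else Some s.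

Definition start (input : seq nat) : state :=
  State 0 (fun _ => 0) (nth 0 input).

Definition outputs_within (W : nat) (P : program) (input : seq nat)
    (time out : nat) : Prop :=
  exists (t : nat) (s : state),
    [/\ t <= time, steps W P t (start input) = Some s,
        size P <= pc s & regs s 0 = out].

(* L lists, for an arbitrary numbering 1, ..., n of the vertices, the
   neighbours of each vertex in an arbitrary order. *)
Definition adjacency_lists (G : graph) (L : seq (seq nat)) : Prop :=
  exists vs : seq G,
    [/\ uniq vs, forall v, v \in vs, size L = size vs
      & forall v, perm_eq (nth [::] L (index v vs))
                          [seq (index w vs).+1 | w <- vs & adj v w]].

(* The number of vertices, h, and the adjacency lists, each ended by a 0. *)
Definition encode (L : seq (seq nat)) (h : nat) : seq nat :=
  [:: size L, h & flatten [seq rcons l 0 | l <- L]].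

(* P computes F on the finite graphs G and integers h satisfying D, in time
   linear in the number of vertices, on words of O(log (n + h)) bits. *)
Definition linear_time_computes (P : program) (D : graph -> nat -> Prop)
    (F : graph -> nat -> option nat) : Prop :=
  exists c : nat, forall (G : graph) (h : nat) (L : seq (seq nat)),
    D G h -> adjacency_lists G L ->
    forall W, c * (size L + h) <= W ->
    exists out : nat, F G h = Some out /\
      outputs_within W P (encode L h) (c * size L) out.

(* Main.v *)
From HB Require Import structures.
Require Import Defs.
From mathcomp Require Import all_boot all_algebra zify.
From mathcomp Require Import boolp classical_sets functions cardinality.

(** A vertex [u] of degree [d] already forces the lower bound: its [d]
    neighbours carry distinct labels, all at circular distance at least [h]
    from [f u], and only [l - 2h + 1] residues modulo [l] are that far from
    [f u] ([C_labelling_span_ge]).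

    For the upper bound take [l = 2h + D - 1], with [D] the maximum degree.
    Then exactly the [D] residues [f u + h, ..., f u + h + D - 1] are available
    around [u]; call this interval [I_u]. If [uv] is an edge and
    [f v = f u + h + k] with [k < D], then [I_v] starts at [f u + 2h + k], which
    is past the end of [I_u] because [D <= h], and it ends at [f u + k] modulo
    [l], which is before the start of [I_u] because [k < h]. So [I_u] and [I_v]
    are disjoint, whatever [k] is. Hence every map that sends [N(u)] injectively
    into [I_u], for every [u], is an elegant C(h,1,1)-labelling: vertices at
    distance 3 are separated because they are neighbours of the two ends of an
    edge. Such a map is an assignment of offsets [off u v < D] to the directed
    edges, injective around each vertex, with [off u v + off v u = D - 1]
    ([edge_offsets]); on a rooted tree it is found from the root downwards, as
    only the offset towards the parent is prescribed at each vertex. This gives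
    the value of both parameters for every tree, finite or infinite
    ([sigma_tree]).

    The algorithm therefore only has to find the maximum degree, by one scan of
    the adjacency lists ([max_degree_program]). It takes linear time because
    the degrees of a tree add up to at most twice the number of vertices
    ([tree_degree_sum]).

    The four special families have maximum degree [m + 1], which is attained
    at a child of the root of [T_{m,k}] (this is where [k >= 2] matters) and of
    [T_{m,oo}], and at the centre of a ball of the regular tree. *)

Set Implicit Arguments.
Unset Strict Implicit.
Unset Printing Implicit Defensive.

Local Open Scope classical_set_scope.
Local Open Scope nat_scope.

(** * Degrees and distances *)

(** Enumerating sequences turn cardinalities, and degrees in particular, into
    sizes that can be counted with. *)
Lemma card_eq_seqP (T : choiceType) (A : set T) (d : nat) :
  (A #= `I_d)%card <->
  exists s : seq T, [/\ uniq s, size s = d & forall x, (x \in s) <-> A x].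
Proof.
split=> [|[s [us <- sA]]].
  case: d => [|d]; first by rewrite II0 card_eq0 => /eqP ->; exists [::].
  rewrite card_eq_sym => card_A.
  have [x0] : A !=set0.
    apply/set0P/eqP => A0; move: card_A; rewrite A0 card_eq0.
    by move=> /eqP/seteqP[/(_ 0)/(_ isT)].
  pose T' : pointedType := HB.pack T (isPointed.Build T x0).
  have /(@card_set_bijP _ T') [f [fA f_inj f_surj]] := card_A.
  exists (map f (iota 0 d.+1)); split; first 1 last.
  - by rewrite size_map size_iota.
  - move=> x; split=> [/mapP[i]|Ax].
      by rewrite mem_iota add0n => /= i_lt ->; apply: fA.
    by have [i i_lt <-] := f_surj x Ax; apply: map_f; rewrite mem_iota.
  rewrite map_inj_in_uniq ?iota_uniq // => i j.
  rewrite !mem_iota /= => i_lt j_lt.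
  by apply: f_inj; rewrite inE.
have -> : A = [set` s] by apply/seteqP; split=> x /sA.
case: s us {sA} => [|x0 s] us.
  by rewrite II0 card_eq0; apply/eqP; rewrite -subset0.
rewrite card_eq_sym.
pose T' : pointedType := HB.pack T (isPointed.Build T x0).
apply/(@card_set_bijP _ T'); exists (nth x0 (x0 :: s)); split.
- by move=> i /= i_lt; apply: mem_nth.
- by move=> i j; rewrite !inE => i_lt j_lt /eqP; rewrite nth_uniq // => /eqP.
- by move=> x /(nthP x0)[i i_lt <-]; exists i.
Qed.

Lemma has_degreeP (G : graph) (u : G) (d : nat) :
  has_degree u d <->
  exists s : seq G, [/\ uniq s, size s = d & forall v, (v \in s) = adj u v].
Proof.
rewrite /has_degree card_eq_seqP.
split=> -[s [us ss sE]]; exists s; split=> // v.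
  by apply/idP/idP => /sE.
by rewrite sE.
Qed.

Lemma dist_le (G : graph) (u v : G) (n : nat) (p : seq G) :
  dist u v = Some n -> path (@adj G) u p -> last u p = v -> n <= size p.
Proof. by move=> /minnatP[_ min_n] up pv; apply: min_n; exists p. Qed.

Lemma dist1 (G : graph) (u v : G) : dist u v = Some 1 <-> adj u v.
Proof.
split=> [/minnatP[[[|w [|? ?]] [//=]]]|uv].
  by rewrite andbT => uw <-.
apply/minnatP; split=> [|n [[|? ?] [/= _ uv' <-]]//].
  by exists [:: v]; rewrite /= uv.
by move: uv; rewrite uv' adj_irr.
Qed.

Lemma dist_walk (G : graph) (u v : G) n : dist u v = Some n ->
  exists p, [/\ path (@adj G) u p, last u p = v & size p = n].
Proof. by move=> /minnatP[]. Qed.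

Lemma dist2 (G : graph) (u v : G) : dist u v = Some 2 ->
  u <> v /\ exists2 w, adj w u & adj w v.
Proof.
move=> duv; split=> [uv|]; first by have := dist_le duv (p := [::]) isT uv.
have [[|w [|v' [|? ?]]] [//=]] := dist_walk duv.
by rewrite andbT => /andP[uw wv] <- _; exists w; rewrite // adj_sym.
Qed.

Lemma dist3 (G : graph) (u v : G) : dist u v = Some 3 ->
  exists a b, [/\ adj a b, adj a u & adj b v].
Proof.
move=> /dist_walk[[|a [|b [|v' [|? ?]]]] [//=]].
by rewrite andbT => /and3P[ua ab bv] <- _; exists a, b; rewrite (adj_sym a u).
Qed.

(** * Lower bound on the span *)

Lemma sibling_dist (G : graph) (u v w : G) :
  adj u v -> adj u w -> v != w -> dist v w = Some 1 \/ dist v w = Some 2.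
Proof.
move=> uv uw vw; case vw_adj: (adj v w); first by left; apply/dist1.
right; apply/minnatP; split=> [|n [[|a [|b p]] [/=]]].
- by exists [:: u; w]; rewrite /= adj_sym uv uw.
- by move=> _ vw'; rewrite vw' eqxx in vw.
- by rewrite andbT => va aw; rewrite -aw va in vw_adj.
- by move=> _ _ <-.
Qed.

(** The distances [far v] and [0 < circ_norm ..] put the differences
    [f v - f u] modulo [l], for [v] adjacent to [u], at distinct points of
    [[h, l - h]], an interval with [l + 1 - 2h] points. *)
Lemma C_labelling_span_ge (G : graph) (u : G) (d h l : nat) (f : G -> 'I_l) :
  has_degree u d -> 0 < d -> 0 < h -> C_labelling h 1 1 f -> 2 * h + d - 1 <= l.
Proof.
move=> /has_degreeP[s [us <- sE]] s_gt0 h_gt0 Cf.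
have far v : v \in s -> h <= circ_norm l ((f u)%:Z - (f v)%:Z)%R.
  by rewrite sE => uv; have [far1 _ _] := Cf u v; apply/far1/dist1.
pose g v := if f u <= f v then f v - f u else f v + l - f u.
have g_inj : {in s &, injective g}.
  move=> v w vs ws gvw; apply: contraTeq isT => vw.
  have fvw : 0 < circ_norm l ((f v)%:Z - (f w)%:Z)%R.
    have [C1 C2 _] := Cf v w.
    by have [|||/C1|/C2//] := @sibling_dist G u v w; rewrite -?sE //; lia.
  move: gvw fvw; rewrite /g /circ_norm; have := ltn_ord (f v).
  by have := ltn_ord (f w); have := ltn_ord (f u); do 2!case: ifP; lia.
have : size (map g s) <= size (iota h (l + 1 - 2 * h)).
  apply: uniq_leq_size; first by rewrite map_inj_in_uniq.
  move=> _ /mapP[v vs ->]; rewrite mem_iota /g.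
  have := far v vs; rewrite /circ_norm; have := ltn_ord (f v).
  by have := ltn_ord (f u); case: ifP; lia.
by rewrite size_map size_iota; lia.
Qed.

(** * Rooted trees *)

(** For closing a cycle out of two descending walks, and for joining two
    vertices through the root. *)
Lemma walk_rev (G : graph) (u : G) (p : seq G) : path (@adj G) u p ->
  exists q, [/\ path (@adj G) (last u p) q, last (last u p) q = u
    & {subset q <= u :: p}].
Proof.
move=> up; exists (rev (belast u p)); split.
- by rewrite rev_path (eq_path (e' := @adj G)) // => x y; rewrite adj_sym.
- by case: p {up} => //= v p; rewrite rev_cons last_rcons.
- by move=> v; rewrite mem_rev => /mem_belast.
Qed.

Definition level (G : graph) (r v : G) : nat := odflt 0 (dist r v).

Section RootedTree.
Variables (G : graph) (r : G).
Hypothesis treeG : tree G.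
Local Notation lev := (level r).

Lemma dist_level v : dist r v = Some (lev v).
Proof.
rewrite /level /dist /minnat; case: pselect => // -[].
have [p [rp pv]] := treeG.1 r v.
by exists (size p); apply/asboolP; exists p.
Qed.

Lemma level_root : lev r = 0.
Proof. by have := dist_le (dist_level r) (p := [::]) isT erefl; case: lev. Qed.

Lemma level_eq0 v : lev v = 0 -> v = r.
Proof.
by move=> v0; have := dist_level v; rewrite v0 => /dist_walk[[|? ?] []].
Qed.

Lemma level_adj u v : adj u v -> lev v <= (lev u).+1.
Proof.
move=> uv; have [p [rp pu <-]] := dist_walk (dist_level u).
rewrite -(size_rcons p v); apply: dist_le (dist_level v) _ _.
  by rewrite rcons_path rp pu.
by rewrite last_rcons.
Qed.

Lemma predecessor_exists v : v <> r ->
  exists2 u, adj v u & lev v = (lev u).+1.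
Proof.
move=> vr; have [p [+ + pv]] := dist_walk (dist_level v).
case/lastP: p pv => [_ _ /esym//|p w].
rewrite size_rcons last_rcons rcons_path => pv /andP[rp pw wv].
rewrite {}wv in pw; exists (last r p); first by rewrite adj_sym.
apply/eqP; rewrite eqn_leq level_adj // -pv ltnS.
exact: dist_le (dist_level _) rp erefl.
Qed.

(** Repeated passage to a predecessor reaches the root; that all levels on the
    way are below [level r v] is what keeps two such walks away from a given
    vertex. *)
Lemma descending_walk v : exists p : seq G,
  [/\ path (@adj G) v p, last v p = r & {in p, forall w, lev w < lev v}].
Proof.
have [n] := ubnP (lev v); elim: n v => // n IHn v v_lt.
have [->|/predecessor_exists[u vu uv]] := pselect (v = r); first by exists [::].
have [|p [up pr p_lt]] := IHn u; first by rewrite -uv.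
exists (u :: p); split; rewrite //= ?vu // => w.
by rewrite inE uv => /predU1P[->//|/p_lt/ltnW].
Qed.

(** Walks that descend from [u] and from [w] to the root avoid [v], so [u] and
    [w] are joined by a simple path that avoids [v]; with [v] it would close a
    cycle if [u] and [w] differed. The weak inequalities also exclude edges
    inside a level. *)
Lemma predecessor_unique v u w : adj v u -> adj v w ->
  lev u <= lev v -> lev w <= lev v -> u = w.
Proof.
move=> vu vw ule wle; apply: contrapT => /eqP uw.
have [p [up pr p_lt]] := descending_walk u.
have [q [wq qr q_lt]] := descending_walk w.
have [q' [rq' q'w q'_sub]] := walk_rev wq; rewrite qr in rq' q'w.
have [c [uc cw c_nv]] : exists c, [/\ path (@adj G) u c, last u c = w &
    v \notin u :: c].
  exists (p ++ q'); rewrite cat_path last_cat up pr; split=> //.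
  rewrite -cat_cons mem_cat !inE; apply/norP; split; [apply/norP; split|].
  - by apply: contraTneq vu => ->; rewrite adj_irr.
  - by apply/negP => /p_lt; rewrite ltnNge ule.
  - apply/negP => /q'_sub; rewrite inE => /predU1P[wv|/q_lt].
      by rewrite -wv adj_irr in vw.
    by rewrite ltnNge wle.
move: cw uw; case/shortenP: uc => c' uc' uniq_c' sub_c' c'w uw.
have v_nc' : v \notin u :: c'.
  by apply: contra c_nv; rewrite !inE => /orP[->//|/sub_c'->]; rewrite orbT.
apply: (treeG.2 (v :: u :: c')).
  by case: (c') c'w uw => [/= ->|//]; rewrite eqxx.
apply/andP; split; last by rewrite cons_uniq v_nc'.
by rewrite /cycle rcons_path /= vu uc' c'w adj_sym.
Qed.

Lemma level_adj_neq u v : adj u v -> lev u <> lev v.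
Proof.
move=> uv uvE; have [vr|/predecessor_exists[w vw wv]] := pselect (v = r).
  have ur : u = r by apply: level_eq0; rewrite uvE vr level_root.
  by rewrite ur vr adj_irr in uv.
have uw : u = w.
  by apply: (@predecessor_unique v) => //; rewrite 1?adj_sym //; lia.
by move: uvE; rewrite uw; lia.
Qed.

Lemma level_adjE u v : adj u v -> lev v = (lev u).+1 \/ lev u = (lev v).+1.
Proof.
move=> uv; have := level_adj uv; have := level_adj_neq uv.
by rewrite adj_sym in uv; have := level_adj uv; lia.
Qed.

(** For the rotations and the labels below, which are determined from the root
    downwards. Recursion on the level is legitimate because the parent of a
    vertex is unique. *)
Lemma tree_recursion (S : Type) (x0 : S) (next : G -> G -> S -> S) :
  exists F : G -> S, forall u v, adj u v -> lev v = (lev u).+1 ->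
    F v = next u v (F u).
Proof.
pose parent v := xget r [set u | adj v u /\ lev v = (lev u).+1].
have parentE u v : adj u v -> lev v = (lev u).+1 -> parent v = u.
  move=> uv uv_lev; have vu : adj v u by rewrite adj_sym.
  rewrite /parent; case: xgetP => [w _ [vw vw_lev]|/(_ u)[]//].
  by apply: (@predecessor_unique v) => //; lia.
pose F := fix F n v :=
  if n is n'.+1 then next (parent v) v (F n' (parent v)) else x0.
exists (fun v => F (lev v) v) => u v uv uv_lev.
by rewrite uv_lev /= (parentE u).
Qed.

End RootedTree.

(** * An elegant labelling of a tree *)

Definition bounded_degree (G : graph) (D : nat) : Prop :=
  forall u : G, exists2 d, has_degree u d & d <= D.

Lemma modn_lt_add (l a b : nat) : a < l -> b < l ->
  (a + b) %% l = if a + b < l then a + b else a + b - l.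
Proof.
move=> al bl; case: ifP => [/modn_small//|/negbT]; rewrite -leqNgt => lab.
by rewrite -{1}(subnK lab) modnDr modn_small //; lia.
Qed.

(** The two sides are a point of [I_u] and a point of [I_v] for an edge [uv]
    with [f u = a] and [f v = a + h + k]. They differ by [h + k + j - i] modulo
    [l], which lies strictly between [0] and [l] because [i < D <= h]. *)
Lemma adjacent_ranges_disjoint (D h a i j k : nat) (l := 2 * h + D - 1) :
  D <= h -> i < D -> j < D -> k < D ->
  (a + (h + i)) %% l <> ((a + (h + k)) %% l + (h + j)) %% l.
Proof.
move=> Dh iD jD kD /eqP; rewrite modnDml -addnA eqn_modDl.
rewrite modn_small 1?modn_lt_add /l; try lia.
by case: ifP; lia.
Qed.

(** Around each vertex the offsets are the ranks in a list of its neighbours,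
    rotated modulo [D]. A rotation keeps them distinct, and its amount is free:
    it is chosen so that the offset towards the parent is the one prescribed by
    the offset that the parent has given. *)
Lemma edge_offsets (G : graph) (D : nat) : tree G -> bounded_degree G D ->
  exists off : G -> G -> nat, forall u v, adj u v ->
    [/\ off u v < D, off u v + off v u = D - 1
      & forall w, adj u w -> off u v = off u w -> v = w].
Proof.
move=> treeG degG.
have /choice[nbrs nbrsP] : forall u : G, exists s : seq G,
    [/\ uniq s, size s <= D & forall v, (v \in s) = adj u v].
  by move=> u; have [d /has_degreeP[s [us <- sE]] dD] := degG u; exists s.
have rank_lt u v : adj u v -> index v (nbrs u) < D.
  have [_ sD sE] := nbrsP u; rewrite -sE -index_mem => lt_s.
  exact: leq_trans lt_s sD.
have [[r _]|G0] := pselect (exists r : G, True); last first.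
  by exists (fun _ _ => 0) => u; case: G0; exists u.
pose rank u v := index v (nbrs u).
(* The summand D - rank v u cancels the rank of the parent modulo D. *)
have [shift shiftE] := tree_recursion r treeG 0 (fun u v s =>
  D - 1 - (rank u v + s) %% D + (D - rank v u)).
pose off u v := (rank u v + shift u) %% D.
have off_down u v : adj u v -> level r v = (level r u).+1 ->
    off v u = D - 1 - off u v.
  move=> uv uv_lev; have vu : adj v u by rewrite adj_sym.
  have rvu := rank_lt _ _ vu; rewrite {1}/off (shiftE _ _ uv uv_lev) -/(off u v).
  rewrite addnCA subnKC 1?ltnW // modnDr modn_small //; lia.
have off_lt u v : adj u v -> off u v < D.
  by move=> /rank_lt uv; rewrite ltn_pmod //; lia.
exists off => u v uv; split; first exact: off_lt.
  have vu : adj v u by rewrite adj_sym.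
  have := off_lt _ _ uv; have := off_lt _ _ vu.
  case: (level_adjE r treeG uv) => [/(off_down _ _ uv)|/(off_down _ _ vu)];
    by lia.
move=> w uw /eqP; rewrite eqn_modDr !modn_small ?rank_lt // => /eqP rvw.
have [_ _ sE] := nbrsP u.
rewrite -[v](nth_index v (s := nbrs u)) ?sE // -/(rank u v) rvw.
by rewrite nth_index ?sE.
Qed.

(** The offsets are summed up from the root. For [f] to be compatible with an
    edge in both directions, the two increments [h + off u v] and [h + off v u]
    have to add up to the span, which is what [edge_offsets] provides. *)
Lemma elegant_labelling_exists (G : graph) (D h : nat) :
  tree G -> bounded_degree G D -> 0 < D -> D <= h ->
  exists f : G -> 'I_(2 * h + D - 1), C_labelling h 1 1 f /\ elegant f.
Proof.
move=> treeG degG D_gt0 Dh; set l := 2 * h + D - 1.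
have l_gt0 : 0 < l by lia.
have [off offP] := edge_offsets treeG degG.
have [[r _]|G0] := pselect (exists r : G, True); last first.
  by exists (fun u => match G0 (ex_intro _ u I) with end); split=> [u|];
    [|exists (fun=> set0); split=> u]; case: G0; exists u.
have [f fE] := tree_recursion r treeG (Ordinal l_gt0) (fun u v x =>
  Ordinal (ltn_pmod (x + (h + off u v)) l_gt0)).
have f_down u v : adj u v -> level r v = (level r u).+1 ->
    f v = (f u + (h + off u v)) %% l :> nat by move=> uv /(fE _ _ uv)->.
have f_adj u v : adj u v -> f v = (f u + (h + off u v)) %% l :> nat.
  move=> uv; have vu : adj v u by rewrite adj_sym.
  have [//|/(f_down _ _ vu) ->] := level_adjE r treeG uv; first exact: f_down.
  rewrite modnDml; have [off_lt off_sum _] := offP _ _ uv.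
  by rewrite -addnA (_ : h + _ + _ = l) ?modnDr ?modn_small //; lia.
exists f; pose I u := [set x : 'I_l |
  exists2 c, f u + h <= c <= f u + h + (D - 1) & x = c %% l :> nat].
have fI u v : adj u v -> I u (f v).
  move=> uv; exists (f u + (h + off u v)); last exact: f_adj.
  by have [] := offP _ _ uv; lia.
have I_disj u v : adj u v -> I u `&` I v = set0.
  move=> uv; rewrite -subset0 => x [[c c_in xc] [c' c'_in xc']].
  have [off_lt _ _] := offP _ _ uv; have := f_adj _ _ uv.
  move=> fuv; have := xc'; rewrite xc.
  rewrite (_ : c = f u + (h + (c - f u - h))); last by lia.
  rewrite (_ : c' = f v + (h + (c' - f v - h))); last by lia.
  by rewrite {1}fuv; apply: adjacent_ranges_disjoint; lia.
have f_inj u v w : adj u v -> adj u w -> v <> w -> f v <> f w.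
  move=> uv uw vw /(congr1 val) /=; rewrite (f_adj _ _ uv) (f_adj _ _ uw).
  have [vlt _ /(_ w uw) off_inj] := offP _ _ uv; have [wlt _ _] := offP _ _ uw.
  have fu := ltn_ord (f u).
  rewrite !modn_lt_add //; try lia; move=> fvw; apply: vw; apply: off_inj.
  by move: fvw; do 2!case: ifP; lia.
have circ_neq (x y : 'I_l) : x <> y -> 0 < circ_norm l (x%:Z - y%:Z)%R.
  move=> xy; have /eqP : (x : nat) <> y by move=> e; apply/xy/ord_inj.
  by rewrite /circ_norm; have := ltn_ord x; have := ltn_ord y; lia.
split; last first.
  exists I; split=> //.
    move=> u; exists (f u + h), (f u + h + (D - 1)).
    by split; rewrite ?leq_addr.
  by move=> u _ [v uv <-]; apply: fI.
move=> u v; split=> [/dist1 uv|/dist2[uv [w wu wv]]|/dist3[a [b [ab au bv]]]].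
- have [off_lt _ _] := offP _ _ uv; have fu := ltn_ord (f u).
  have := f_adj _ _ uv; rewrite modn_lt_add //; last by lia.
  by rewrite /circ_norm; case: ifP; lia.
- exact/circ_neq/(f_inj w).
- apply: circ_neq => fuv.
  have : (I a `&` I b) (f u) by split; [|rewrite fuv]; apply: fI.
  by rewrite I_disj.
Qed.

(** * The value on a tree *)

Lemma sigma_tree (G : graph) (D h : nat) :
  tree G -> has_max_degree G D -> 0 < D -> D <= h ->
  sigma h 1 1 G = Some (2 * h + D - 1) /\
  sigma_star h 1 1 G = Some (2 * h + D - 1).
Proof.
move=> treeG [degG [u uD]] D_gt0 Dh.
have [f [Cf elegf]] := elegant_labelling_exists treeG degG D_gt0 Dh.
have h_gt0 := leq_trans D_gt0 Dh.
split; apply/minnatP; split=> [|l [_ [g]]].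
- by split; [lia|exists f].
- exact: C_labelling_span_ge uD D_gt0 h_gt0.
- by split; [lia|exists f].
- by move=> [Cg _]; apply: C_labelling_span_ge uD D_gt0 h_gt0 Cg.
Qed.

(** * Degrees in the complete and regular trees *)

Lemma childrenE (G : graph) (r u v : G) : tree G ->
  children r u v <-> adj u v /\ level r v = (level r u).+1.
Proof.
move=> treeG; split=> [[uv [d du dv]]|[uv uv_lev]].
  by rewrite /level du dv.
split=> //; exists (level r u); first exact: dist_level.
by rewrite -uv_lev; apply: dist_level.
Qed.

(** The summand [u != r] counts the parent. *)
Lemma degree_children (G : graph) (r u : G) (c : nat) : tree G ->
  (children r u #= `I_c)%card -> has_degree u (c + (u != r)).
Proof.
move=> treeG /card_eq_seqP[s [us sc sE]]; apply/has_degreeP.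
have [ur|/eqP/(predecessor_exists treeG)[p up p_lev]] := eqVneq u r.
  exists s; split; rewrite ?addn0 // => v.
  apply/idP/idP => [/sE/(childrenE _ _ _ treeG)[]//|uv].
  apply/sE/(childrenE _ _ _ treeG); split=> //.
  by case: (level_adjE r treeG uv) => //; rewrite ur level_root.
exists (p :: s); split=> [||v]; rewrite /= ?us ?sc ?addn1 // ?andbT.
  by apply/negP => /sE/(childrenE _ _ _ treeG)[_]; lia.
rewrite inE; apply/predU1P/idP => [[->//|/sE/(childrenE _ _ _ treeG)[]//]|uv].
have [v_lev|v_lev] := level_adjE r treeG uv.
  by right; apply/sE/(childrenE _ _ _ treeG).
by left; apply: (predecessor_unique treeG uv up (r := r)); lia.
Qed.

(** The degree [m + 1] needs a vertex that has both a parent and children,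
    hence the assumption on the first two levels. *)
Lemma rooted_max_degree (G : graph) (r : G) (m : nat) : tree G -> 0 < m ->
  (forall u, children r u <> set0 -> (children r u #= `I_m)%card) ->
  (forall u, level r u < 2 -> children r u <> set0) ->
  has_max_degree G m.+1.
Proof.
move=> treeG m_gt0 card_children inner; split=> [u|].
  have [u0|/card_children/(degree_children treeG) deg_u] :=
    pselect (children r u = set0); last first.
    by exists (m + (u != r)); rewrite // -addn1 leq_add2l leq_b1.
  exists (0 + (u != r)); last by rewrite (leq_trans (leq_b1 _)).
  by apply: degree_children; rewrite // u0 II0 card_eq0.
have /inner/eqP/set0P[v] : level r r < 2 by rewrite level_root.
move=> /(childrenE _ _ _ treeG)[rv]; rewrite level_root // => v_lev.
have /inner/card_children/(degree_children treeG) : level r v < 2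
  by rewrite v_lev.
have vr : v != r by apply: contraTneq rv => ->; rewrite adj_irr.
by rewrite vr addn1; exists v.
Qed.

Lemma complete_tree_max_degree (m k : nat) (G : graph) : 0 < m -> 2 <= k ->
  complete_tree m k G -> tree G /\ has_max_degree G m.+1.
Proof.
move=> m_gt0 k_ge2 [treeG [r rP]]; split=> //.
apply: (rooted_max_degree (r := r)) => // u; first by have [] := rP u.
have [_ leaf _] := rP u; rewrite /level => lev_u /leaf u_k.
by move: lev_u; rewrite u_k /=; lia.
Qed.

Lemma complete_tree_infty_max_degree (m : nat) (G : graph) : 0 < m ->
  complete_tree_infty m G -> tree G /\ has_max_degree G m.+1.
Proof.
move=> m_gt0 [treeG _ [r rP]]; split=> //.
apply: (rooted_max_degree (r := r)) => // u _ u0; have := rP u.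
rewrite u0 card_eq_sym card_eq0 => /eqP/seteqP[/(_ 0) + _].
by apply.
Qed.

Lemma regular_tree_max_degree (m : nat) (G : graph) :
  regular_tree m G -> tree G /\ has_max_degree G m.+1.
Proof.
move=> [treeG infG degG]; split=> //; split=> [u|]; first by exists m.+1.
have [[u _]|G0] := pselect (exists u : G, True); first by exists u.
case: infG; suff -> : [set: G] = set0 by apply: finite_set0.
by rewrite -subset0 => u _; case: G0; exists u.
Qed.

Lemma induced_walk (G : graph) (P : pred G) (u : induced P) (p : seq G) :
  path (@adj G) (val u) p -> all P p ->
  exists2 q, path (@adj (induced P)) u q & val (last u q) = last (val u) p.
Proof.
elim: p u => [|v p IHp] u /=; first by exists [::].
move=> /andP[uv vp] /andP[Pv Pp].
have [q vq qE] := IHp (exist _ v Pv) vp Pp.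
by exists (exist _ v Pv :: q); rewrite //= vq andbT.
Qed.

Lemma induced_acyclic (G : graph) (P : pred G) :
  acyclic_graph G -> acyclic_graph (induced P).
Proof.
move=> acG c c_gt2 /andP[cyc_c uniq_c]; apply: (acG (map val c)).
  by rewrite size_map.
apply/andP; split; last by rewrite map_inj_uniq //; apply: val_inj.
by rewrite cycle_map.
Qed.

Lemma in_ballE (G : graph) (x v : G) (k : nat) : tree G ->
  in_ball x k v = (level x v <= k).
Proof. by move=> treeG; rewrite /in_ball (dist_level x treeG). Qed.

Lemma ball_tree (G : graph) (x : G) (k : nat) :
  tree G -> tree (induced (in_ball x k)).
Proof.
move=> treeG; split; last exact: induced_acyclic treeG.2.
have x_in : in_ball x k x by rewrite in_ballE // level_root.
pose x' : induced (in_ball x k) := exist _ x x_in.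
have to_x (u : induced (in_ball x k)) :
    exists2 p, path (@adj _) u p & last u p = x'.
  have [p [up px p_lt]] := descending_walk x treeG (val u).
  have [|q uq qx] := induced_walk up.
    apply/allP => w /p_lt; rewrite in_ballE // => /ltnW /leq_trans; apply.
    by have := valP u; rewrite in_ballE.
  by exists q => //; apply: val_inj; rewrite qx.
move=> u v; have [p up px] := to_x u; have [q vq qx] := to_x v.
have [q' [xq' q'v _]] := walk_rev vq.
by exists (p ++ q'); rewrite cat_path last_cat up px -qx.
Qed.

Lemma ball_max_degree (m k : nat) (G : graph) : 0 < k ->
  regular_tree_ball m k G -> tree G /\ has_max_degree G m.+1.
Proof.
move=> k_gt0 [H [x [[treeH _ degH] ->]]]; split; first exact: ball_tree.
have deg (u : induced (in_ball x k)) : exists s : seq H,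
    [/\ size s = m.+1, forall w, (w \in s) = adj (val u) w
      & has_degree u (count (in_ball x k) s)].
  have /has_degreeP[s [us ss sE]] := degH (val u); exists s; split=> //.
  apply/has_degreeP; exists (pmap insub s); split.
  - exact: pmap_sub_uniq.
  - exact: size_pmap_sub.
  - by move=> w; rewrite mem_pmap_sub sE.
split=> [u|].
  have [s [ss _ deg_u]] := deg u; eexists; first exact: deg_u.
  by rewrite -ss count_size.
have x_in : in_ball x k x by rewrite in_ballE // level_root.
pose x' : induced (in_ball x k) := exist _ x x_in.
have [s [ss sE deg_x]] := deg x'; exists x'.
suff /eqP <- : count (in_ball x k) s == m.+1 by [].
rewrite -ss -all_count; apply/allP => w; rewrite sE => xw.
rewrite in_ballE //; apply: leq_trans (level_adj x treeH xw) _.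
by rewrite level_root.
Qed.

(** * The linear-time algorithm *)

(** The handshake argument: each edge joins a vertex to one of no higher level,
    and by [predecessor_unique] every vertex has at most one such neighbour, so
    there are at most [size vs] edges. *)
Lemma tree_degree_sum (G : graph) (vs : seq G) : tree G -> uniq vs ->
  \sum_(v <- vs) count (@adj G v) vs <= 2 * size vs.
Proof.
case: vs => [|r vs'] treeG; first by rewrite big_nil.
move: (r :: vs') => vs uniq_vs.
pose up v w := adj v w && (level r w <= level r v).
have up_le1 v : count (up v) vs <= 1.
  rewrite -size_filter; case fE: (filter _ _) => [//|u s].
  rewrite -fE -[1]/(size [:: u]); apply: uniq_leq_size.
    exact: filter_uniq.
  have : u \in filter (up v) vs by rewrite fE mem_head.
  rewrite mem_filter => /andP[/andP[vu u_lev] _] w.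
  rewrite mem_filter inE => /andP[/andP[vw w_lev] _].
  by apply/eqP; apply: (predecessor_unique treeG vw vu w_lev u_lev).
have up_sum : \sum_(v <- vs) count (up v) vs <= size vs.
  by rewrite -sum1_size; apply: leq_sum => v _; apply: up_le1.
rewrite mul2n -addnn; apply: leq_trans (leq_add up_sum up_sum).
under [X in _ <= _ + X]eq_bigr do rewrite -sumn_count sumnE big_map.
rewrite exchange_big -big_split; apply: leq_sum => v _ /=.
rewrite -!sumn_count !sumnE !big_map -big_split; apply: leq_sum => w _ /=.
rewrite /up (adj_sym w v); case: (adj v w) => //.
by case: (leqP (level r w)) => // /ltnW ->.
Qed.

(** Register 0 holds the largest list length found so far and finally the
    output, register 1 the reading position, register 2 the number of lists that
    remain, register 3 the length of the current list as far as it has been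
    read, register 4 the entry just read; registers 5, 6 and 7 hold the
    constants 1, 0 and [h]. The lines of the program are the initialization, the
    test that lists remain (at 4), the scan of one list (from 5), the update of
    the maximum (from 10) and the computation of [2h + D - 1] (from 15). *)
Definition max_degree_program : program :=
  [:: IConst 5 1; IRead 2 6; IRead 7 5; IConst 1 2;
      IJle 2 6 15;
      IRead 4 1; IAdd 1 1 5; IJle 4 6 10; IAdd 3 3 5; IJle 6 6 5;
      IJle 3 0 12; IAdd 0 3 6; ISub 3 6 6; ISub 2 2 5; IJle 6 6 4;
      IAdd 0 0 7; IAdd 0 0 7; ISub 0 0 5].

Section Execution.
Variables (W h : nat) (inp : seq nat).

Definition reaches (t : nat) (s : state) (Q : state -> Prop) : Prop :=
  exists t' s', [/\ t' <= t, steps W max_degree_program t' s = Some s' & Q s'].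

Lemma reaches_now t s (Q : state -> Prop) : Q s -> reaches t s Q.
Proof. by move=> Qs; exists 0, s. Qed.

(** Symbolic execution: simplification of [step] at a known program counter
    leaves only the word-size test, or the comparison, to be decided. *)
Lemma reaches_step t s Q :
  (if step W max_degree_program s is Some s' then reaches t s' Q else False) ->
  reaches t.+1 s Q.
Proof.
case sE: step => [s1|//] [t' [s' [t't s1s' Qs']]].
by exists t'.+1, s'; rewrite /= sE.
Qed.

Lemma reaches_trans t1 t2 s Q Q' :
  reaches t1 s Q -> (forall s', Q s' -> reaches t2 s' Q') ->
  reaches (t1 + t2) s Q'.
Proof.
move=> [t1' [s1 [t1_le s_s1 Qs1]]] /(_ _ Qs1)[t2' [s2 [t2_le s12 Qs2]]].
exists (t1' + t2'), s2; split; rewrite ?leq_add //.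
elim: t1' s s_s1 {t1_le} => [s [->]//|t IHt s] /=.
by case: step => //= s'; apply: IHt.
Qed.

(** The machine at instruction [i], with [m], [p], [n] and [c] in the working
    registers 0 to 3. Register 4 is left out, as the value of an entry
    does not outlive its treatment. *)
Definition scanning (i m p n c : nat) (s : state) : Prop :=
  [/\ pc s = i, memory s = nth 0 inp,
      [/\ regs s 0 = m, regs s 1 = p, regs s 2 = n & regs s 3 = c]
    & [/\ regs s 5 = 1, regs s 6 = 0 & regs s 7 = h]].

Hypothesis inp_W : {in inp, forall x, x < W}.
Hypothesis size_W : 2 * h + size inp < W.

(** Five instructions for an entry and three for the terminating 0. The bound on
    [c + size l] is what makes the counter fit in a word. *)
Lemma scan_list l rest p m n c s :
  drop p inp = rcons l 0 ++ rest -> 0 \notin l -> c + size l <= size inp ->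
  scanning 5 m p n c s ->
  reaches (5 * size l + 3) s (fun s' =>
    scanning 10 m (p + (size l).+1) n (c + size l) s' /\
    drop (p + (size l).+1) inp = rest).
Proof.
elim: l p c s => [|x l IHl] p c [pc R M] pE l0 cl
  [/= -> -> [R0 R1 R2 R3] [R5 R6 R7]].
  have p_lt : p < size inp
    by rewrite ltnNge; apply/negP => /drop_oversize; rewrite pE.
  have px : nth 0 inp p = 0 by rewrite -[p]addn0 -nth_drop pE.
  apply: reaches_step; rewrite /step /= /set_reg /= R1 px ifT; last by lia.
  apply: reaches_step; rewrite /step /= /set_reg /= R1 R5 ifT; last by lia.
  apply: reaches_step; rewrite /step /=.
  apply: reaches_now; split; last first.
    by rewrite addn1 -add1n -drop_drop pE /= drop0.
  by split; rewrite //= addn0.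
have p_lt : p < size inp
  by rewrite ltnNge; apply/negP => /drop_oversize; rewrite pE.
have px : nth 0 inp p = x by rewrite -[p]addn0 -nth_drop pE.
have x_W : x < W by rewrite -px; apply/inp_W/mem_nth.
move: l0 cl; rewrite inE negb_or eq_sym -lt0n /= => /andP[x_gt0 l0] cl.
rewrite (_ : 5 * (size l).+1 + 3 = (5 * size l + 3).+4.+1); last by lia.
apply: reaches_step; rewrite /step /= /set_reg /= R1 px x_W.
apply: reaches_step; rewrite /step /= /set_reg /= R1 R5 ifT; last by lia.
apply: reaches_step; rewrite /step /= R6 leqNgt x_gt0 /=.
apply: reaches_step; rewrite /step /= /set_reg /= R3 R5 ifT; last by lia.
apply: reaches_step; rewrite /step /= leqnn.
rewrite (_ : p + (size l).+2 = p + 1 + (size l).+1); last by lia.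
rewrite (_ : c + (size l).+1 = c + 1 + size l); last by lia.
apply: IHl => //; last by rewrite -addnA add1n.
by rewrite addn1 -add1n -drop_drop pE /= drop0.
Qed.

Lemma finish_list m p n c s :
  c < W -> n < W -> scanning 10 m p n.+1 c s ->
  reaches 5 s (scanning 4 (maxn m c) p n 0).
Proof.
move=> cW nW; case: s => [pc R M] [/= -> -> [R0 R1 R2 R3] [R5 R6 R7]].
apply: reaches_step; rewrite /step /= R3 R0.
have [cm|mc] := leqP c m.
  apply: reaches_step; rewrite /step /= /set_reg /= R6 ifT; last by lia.
  apply: reaches_step; rewrite /step /= /set_reg /= R2 R5 subn1 ifT //.
  apply: reaches_step; rewrite /step /= R6 /=.
  exact: reaches_now.
apply: reaches_step; rewrite /step /= /set_reg /= R3 R6 addn0 ifT //.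
apply: reaches_step; rewrite /step /= /set_reg /= R6 ifT; last by lia.
apply: reaches_step; rewrite /step /= /set_reg /= R2 R5 subn1 ifT //.
apply: reaches_step; rewrite /step /= R6 /=.
by apply: reaches_now; split.
Qed.

(** Nine instructions for a list besides those for its entries: the test at 4,
    three for the terminator and at most five for the update. *)
Lemma scan_all Ls p m s :
  drop p inp = flatten [seq rcons l 0 | l <- Ls] ->
  all (fun l => 0 \notin l) Ls ->
  size Ls <= size inp -> scanning 4 m p (size Ls) 0 s ->
  reaches (5 * \sum_(l <- Ls) size l + 9 * size Ls + 1) s (fun s' =>
    exists p', scanning 15 (maxn m (\max_(l <- Ls) size l)) p' 0 0 s').
Proof.
elim: Ls p m s => [|l Ls IHLs] p m [pc R M] pE.
  move=> _ _ [/= -> -> [R0 R1 R2 R3] [R5 R6 R7]]; rewrite !big_nil maxn0.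
  apply: reaches_step; rewrite /step /= R2 /=.
  by apply: reaches_now; exists p.
move=> /= /andP[l0 Ls0] Ls_inp [/= -> -> [R0 R1 R2 R3] [R5 R6 R7]].
rewrite !big_cons maxnA.
have pE_size := congr1 size pE.
rewrite size_drop /= size_cat size_rcons in pE_size.
rewrite (_ : _ + 1 = (5 * size l + 3 +
  (5 + (5 * \sum_(l' <- Ls) size l' + 9 * size Ls + 1))).+1); last by lia.
apply: reaches_step; rewrite /step /= R2 R6 /=.
apply: reaches_trans.
  apply: (scan_list (l := l) (p := p) (m := m)
    (n := (size Ls).+1) (c := 0)) => //.
  - exact: pE.
  - by lia.
move=> s [s_at rest]; apply: reaches_trans.
  by apply: finish_list s_at; lia.
by move=> s' s'_at; apply: IHLs s'_at => //; lia.
Qed.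

Lemma max_degree_program_run L :
  inp = encode L h -> all (fun l => 0 \notin l) L ->
  reaches (5 * \sum_(l <- L) size l + 9 * size L + 8) (start inp)
    (fun s => pc s = 18 /\ regs s 0 = 2 * h + \max_(l <- L) size l - 1).
Proof.
move=> inpE L0.
have n_W : size L < W by apply: inp_W; rewrite inpE mem_head.
have size_inp : size inp = 2 + \sum_(l <- L) (size l).+1.
  rewrite inpE /= size_flatten sumnE big_map big_map.
  by under eq_bigr do rewrite size_rcons.
have max_le : \max_(l <- L) size l + size L <= size inp.
  rewrite size_inp; elim: (L) => [|l L' IHL]; first by rewrite !big_nil.
  by rewrite !big_cons /=; lia.
rewrite (_ : _ + 8 = 4 + (5 * \sum_(l <- L) size l + 9 * size L + 1 + 3));
  last by lia.
apply: (reaches_trans (Q := scanning 4 0 2 (size L) 0)).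
  apply: reaches_step; rewrite /step /= /set_reg /= ifT; last by lia.
  apply: reaches_step; rewrite /step /= /set_reg /= {1 2}inpE /= n_W.
  apply: reaches_step; rewrite /step /= /set_reg /= {1 2}inpE /= ifT;
    last by lia.
  apply: reaches_step; rewrite /step /= /set_reg /= ifT; last by lia.
  by apply: reaches_now; split => //; split=> //=; rewrite inpE.
move=> s s_at; apply: reaches_trans.
  by apply: (scan_all (Ls := L) _ _ _ s_at) => //; [rewrite inpE /= drop0|lia].
move=> [pc R M] [p' [/= -> -> [R0 R1 R2 R3] [R5 R6 R7]]].
rewrite max0n in R0.
apply: reaches_step; rewrite /step /= /set_reg /= R0 R7 ifT; last by lia.
apply: reaches_step; rewrite /step /= /set_reg /= R7 ifT; last by lia.
apply: reaches_step; rewrite /step /= /set_reg /= R5 ifT; last by lia.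
by apply: reaches_now; split=> //=; lia.
Qed.

End Execution.

Lemma degree_count (G : graph) (v : G) (d : nat) (vs : seq G) :
  uniq vs -> (forall w, w \in vs) -> has_degree v d -> count (@adj G v) vs = d.
Proof.
move=> uniq_vs all_vs /has_degreeP[s [us <- sE]]; rewrite -size_filter.
apply/perm_size/uniq_perm => //; first exact: filter_uniq.
by move=> w; rewrite mem_filter all_vs andbT sE.
Qed.

(** What the machine sees of a tree: the lengths of the lists are the degrees,
    and only the terminators are 0. *)
Lemma tree_adjacency_lists (G : graph) (L : seq (seq nat)) (D : nat) :
  tree G -> has_max_degree G D -> adjacency_lists G L ->
  [/\ 0 < size L, \max_(l <- L) size l = D, \sum_(l <- L) size l <= 2 * size L
    & {in L, forall l, {in l, forall x, 0 < x <= size L}}].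
Proof.
move=> treeG [degG [u uD]] [vs [uniq_vs all_vs sL nbrsE]].
pose nbrs v := nth [::] L (index v vs).
have LE : L = [seq nbrs v | v <- vs].
  apply: (@eq_from_nth _ [::]); rewrite ?size_map sL // => i i_lt.
  by rewrite (nth_map u) // /nbrs index_uniq.
have size_nbrs v : size (nbrs v) = count (@adj G v) vs.
  by rewrite (perm_size (nbrsE v)) size_map size_filter.
split.
- by rewrite sL; have := all_vs u; case: (vs).
- rewrite LE big_map; apply/eqP; rewrite eqn_leq; apply/andP; split.
    apply/bigmax_leqP_seq => v _ _; have [d vd dD] := degG v.
    by rewrite size_nbrs (degree_count uniq_vs all_vs vd).
  have <- : size (nbrs u) = D.
    by rewrite size_nbrs (degree_count uniq_vs all_vs uD).
  by apply: (@leq_bigmax_seq _ vs xpredT (size \o nbrs)); rewrite ?all_vs.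
- rewrite {1}LE big_map sL; apply: leq_trans (tree_degree_sum treeG uniq_vs).
  by apply: leq_sum => v _; rewrite size_nbrs.
- move=> l; rewrite {1}LE => /mapP[v _ ->] x.
  rewrite (perm_mem (nbrsE v)) => /mapP[w _ ->].
  by rewrite sL index_mem all_vs.
Qed.

Lemma max_degree_program_linear_time :
  linear_time_computes max_degree_program
    (fun T h => [/\ tree T, finite_graph T, diameter_ge T 3 &
       exists Delta, [/\ has_max_degree T Delta, 3 <= Delta & Delta <= h]])
    (fun T h => sigma h 1 1 T).
Proof.
(* The run takes at most 5 * (2n) + 9n + 8 <= 27n steps, and every word is
   at most 2h + 3n + 2, where n is the number of vertices. *)
exists 30 => G h L [treeG _ _ [D [degG D_ge3 Dh]]] adjL W W_large.
have [L_gt0 maxE sum_le entries] := tree_adjacency_lists treeG degG adjL.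
have D_gt0 : 0 < D by lia.
exists (2 * h + D - 1); split.
  by have [] := sigma_tree treeG degG D_gt0 Dh.
have inp_W : {in encode L h, forall x, x < W}.
  move=> x; rewrite /encode !inE => /or3P[/eqP->|/eqP->|]; try lia.
  move=> /flattenP[_ /mapP[l lL ->]]; rewrite mem_rcons inE.
  by move=> /predU1P[->|/(entries _ lL)]; lia.
have size_W : 2 * h + size (encode L h) < W.
  rewrite /= size_flatten /shape -map_comp sumnE big_map.
  under eq_bigr do rewrite /= size_rcons -addn1.
  by rewrite big_split sum1_size /=; lia.
have L0 : all (fun l => 0 \notin l) L.
  by apply/allP => l lL; apply/negP => /(entries _ lL).
have [t [s [t_le run [s_pc s_out]]]] :=
  max_degree_program_run inp_W size_W erefl L0.
exists t, s; split=> //; last by rewrite s_out maxE.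
  by lia.
by rewrite s_pc.
Qed.

Theorem corollary4p2 :
  [/\ forall (T : graph) (Delta h : nat),
        tree T ->
        (finite_graph T /\ diameter_ge T 3) \/ infinite_graph T ->
        has_max_degree T Delta -> 3 <= Delta -> Delta <= h ->
        sigma h 1 1 T = sigma_star h 1 1 T /\
        sigma_star h 1 1 T = Some (2 * h + Delta - 1),
      exists P : program,
        linear_time_computes P
          (fun T h => [/\ tree T, finite_graph T, diameter_ge T 3 &
             exists Delta, [/\ has_max_degree T Delta, 3 <= Delta & Delta <= h]])
          (fun T h => sigma h 1 1 T)
    & forall (m k h : nat) (T : graph),
        2 <= m -> 2 <= k -> m + 1 <= h ->
        [\/ complete_tree m k T, complete_tree_infty m T,
            regular_tree_ball m k T | regular_tree m T] ->
        sigma h 1 1 T = sigma_star h 1 1 T /\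
        sigma_star h 1 1 T = Some (2 * h + m)].
Proof.
split=> [T Delta h treeT _ degT Delta_ge3 Delta_h||m k h T m_ge2 k_ge2 mh T_shape].
- have [] := sigma_tree treeT degT _ Delta_h; first by lia.
  by move=> -> ->.
- by exists max_degree_program; apply: max_degree_program_linear_time.
have m_gt0 : 0 < m by lia.
have [treeT degT] : tree T /\ has_max_degree T m.+1.
  case: T_shape.
  - exact: complete_tree_max_degree.
  - exact: complete_tree_infty_max_degree.
  - by apply: ball_max_degree; lia.
  - exact: regular_tree_max_degree.
have [||-> ->] := sigma_tree treeT degT (h := h); try lia.
by split=> //; congr Some; lia.
Qed.
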